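(* Let $X$ be a Hausdorff space and let $(X,f)$ be a quasi-continuous dynamical system with isolated points (i.e. $\mathrm{Iso}_X\neq\emptyset$). Assume that $(X,f)$ satisfies $\mathrm{TT}$. (1) If there is a (unique) point $x\in\mathrm{Iso}_X$ such that $f^{-1}(x)=\emptyset$, then $(X,f)$ satisfies $\mathrm{DO}_+$ and $x$ is the unique transitive point. In this case, none of $\mathrm{TT}_+$, $\mathrm{TT}_{++}$ or $\mathrm{DO}_{++}$ holds. (2) If $|f^{-1}(x)|=1$ for every $x\in\mathrm{Iso}_X$, then either all of $\mathrm{DO}_+$, $\mathrm{TT}_+$, $\mathrm{TT}_{++}$ and $\mathrm{DO}_{++}$ hold, or none of them hold. (3) If $f^{-1}(z)\neq\emptyset$ for every point $z\in\mathrm{Iso}_X$ and there is a (unique) point $x\in\mathrm{Iso}_X$ such that $|f^{-1}(x)|=2$, then none of $\mathrm{DO}_+$, $\mathrm{TT}_+$, $\mathrm{DO}_{++}$ and $\mathrm{TT}_{++}$ hold.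
   Context: $\mathbb N$ denotes the set of nonnegative integers. A dynamical system is a pair $(X,f)$ where $X$ is a topological space with at least two points and $f:X\to X$ is a map, not necessarily continuous. A map $g:X\to Y$ between topological spaces is quasi-continuous if for every $x_0\in X$, every open neighbourhood $W$ of $g(x_0)$ and every open neighbourhood $U$ of $x_0$, there is a nonempty open set $V\subseteq U$ with $g(V)\subseteq W$. The system $(X,f)$ is quasi-continuous if $f^n$ is quasi-continuous for every $n\in\mathbb N$. $\mathrm{Iso}_X$ is the set of isolated points of $X$; $f^{-1}(x)$ is the preimage of $\{x\}$. For $A,B\subseteq X$, $N(A,B)=\{n\in\mathbb Z: f^n(A)\cap B\neq\emptyset\}$, where for $n<0$, $f^{n}(A)$ means the preimage $(f^{-n})^{-1}(A)$; and $N_+(A,B)=N(A,B)\cap\mathbb N$. TT: for every pair of nonempty open $U,V\subseteq X$, $N(U,V)\neq\emptyset$. TT$_+$: for every pair of nonempty open $U,V\subseteq X$, $N_+(U,V)\ne\emptyset$. TT$_{++}$: for every pair of nonempty open $U,V\subseteq X$, $N_+(U,V)$ is infinite. $\mathrm{Orb}_f(x)=\{f^n(x):n\in\mathbb N\}$ and $\omega f(x)=\bigcap_{k\in\mathbb N}\overline{\{f^n(x):n\ge k\}}$. A point $x$ is transitive if $\mathrm{Orb}_f(x)$ is dense in $X$. DO$_+$: there is $x\in X$ with $\mathrm{Orb}_f(x)$ dense in $X$. DO$_{++}$: there is $x\in X$ with $\omega f(x)=X$. *)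

(* Defs.v *)
From mathcomp Require Import all_boot all_order all_algebra.
From mathcomp Require Import all_classical topology.

Set Implicit Arguments.
Unset Strict Implicit.
Unset Printing Implicit Defensive.

Local Open Scope classical_set_scope.

Definition quasi_continuous (X Y : topologicalType) (g : X -> Y) : Prop :=
  forall (x0 : X) (W : set Y) (U : set X),
    open W -> W (g x0) -> open U -> U x0 ->
    exists V : set X, [/\ open V, V !=set0, V `<=` U & g @` V `<=` W].

Definition quasi_continuous_system (X : topologicalType) (f : X -> X) : Prop :=
  forall n : nat, quasi_continuous (iter n f).

Definition Iso (X : topologicalType) : set X := isolated [set: X].
Arguments Iso X : clear implicits.

(* [Negz n] is the integer -(n+1). *)
Definition zimage (X : Type) (f : X -> X) (n : int) (A : set X) : set X :=
  match n with
  | Posz m => iter m f @` A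
  | Negz m => iter m.+1 f @^-1` A
  end.

Definition hitting (X : Type) (f : X -> X) (A B : set X) : set int :=
  [set n | zimage f n A `&` B !=set0].

(* The intersection with N, taken as a subset of [nat]. *)
Definition hitting_pos (X : Type) (f : X -> X) (A B : set X) : set nat :=
  Posz @^-1` hitting f A B.

Definition TT (X : topologicalType) (f : X -> X) : Prop :=
  forall U V : set X, open U -> U !=set0 -> open V -> V !=set0 ->
    hitting f U V !=set0.

Definition TTp (X : topologicalType) (f : X -> X) : Prop :=
  forall U V : set X, open U -> U !=set0 -> open V -> V !=set0 ->
    hitting_pos f U V !=set0.

Definition TTpp (X : topologicalType) (f : X -> X) : Prop :=
  forall U V : set X, open U -> U !=set0 -> open V -> V !=set0 ->
    infinite_set (hitting_pos f U V).

Definition orbit (X : Type) (f : X -> X) (x : X) : set X :=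
  [set iter n f x | n in [set: nat]].

Definition omega_limit (X : topologicalType) (f : X -> X) (x : X) : set X :=
  \bigcap_(k in [set: nat]) closure [set iter n f x | n in [set n | (k <= n)%N]].

Definition transitive_point (X : topologicalType) (f : X -> X) (x : X) : Prop :=
  dense (orbit f x).

Definition DOp (X : topologicalType) (f : X -> X) : Prop :=
  exists x : X, dense (orbit f x).

Definition DOpp (X : topologicalType) (f : X -> X) : Prop :=
  exists x : X, omega_limit f x = [set: X].

(* Main.v *)
Require Import Defs.
From mathcomp Require Import all_boot all_order all_algebra.
From mathcomp Require Import all_classical topology.
Set Implicit Arguments.
Unset Strict Implicit.
Unset Printing Implicit Defensive.

Local Open Scope classical_set_scope.

(** An isolated point [x] is one for which [{x}] is open, so transitivity can be
    tested on singletons: under TT, any two isolated points lie one on the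
    forward orbit of the other ([TT_isolated]), and a dense orbit visits every
    isolated point.  Quasi-continuity transports isolation backwards: a fiber
    over an isolated point contains a nonempty open subset of every neighbourhood
    of each of its points, so a point that can be separated from the rest of
    such a fiber is isolated ([isolated_of_fiber]).

    If the isolated point [x] has no preimage, it can be reached only at time 0.
    Hence its own orbit is the only dense one, no open set missing [x] ever
    reaches it, and it is in no omega-limit set.

    If each fiber over an isolated point is a singleton, isolation propagates
    along the whole backward orbit.  A dense orbit then starts at an isolated
    point whose preimage it visits as well, so it is a cycle, and a dense cycle
    has all the recurrence one can ask for ([dense_cycle_TTpp],
    [dense_cycle_DOpp]).  In the same way TT+ puts a dense set of isolated points
    on a single forward orbit.

    If the isolated point [x] has two preimages, both are isolated, and one lies
    ahead of the other.  The latter one is on a cycle through [x]; the former,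
    [c], is not, as [f] is injective on cycles ([branching]).  So the
    orbit of [c] never comes back to [c], which refutes TT+.  Since [c] is not
    periodic, TT forces the iterated fibers of [c] to be singletons
    ([nonperiodic_fiber]), hence isolated points at every depth
    ([nonperiodic_backward_chain]).  A dense orbit would have to visit [c] at a
    time [m] and also a point lying [m + 1] steps behind [c], which would make
    [c] periodic. *)

(** * Periodic points *)

Definition periodic (X : Type) (f : X -> X) (x : X) : Prop :=
  exists2 n, (0 < n)%N & iter n f x = x.

Lemma iter_fixM (X : Type) (f : X -> X) (n k : nat) (x : X) :
  iter n f x = x -> iter (n * k) f x = x.
Proof. by move=> fx; rewrite mulnC iterM iter_fix. Qed.

Lemma periodic_iter (X : Type) (f : X -> X) (n : nat) (x : X) :
  periodic f x -> periodic f (iter n f x).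
Proof. by case=> p p0 fx; exists p => //; rewrite -iterD addnC iterD fx. Qed.

(** Going once around both cycles inverts one application of [f] on each of the
    two points. *)
Lemma periodic_inj (X : Type) (f : X -> X) (a b : X) :
  periodic f a -> periodic f b -> f a = f b -> a = b.
Proof.
move=> [k k0 fa] [n n0 fb] fab.
have := iter_fixM n fa; have := iter_fixM k fb; rewrite mulnC.
case: (k * n)%N (muln_gt0 k n) => [|q _]; first by rewrite k0 n0.
by rewrite !iterSr fab => -> ->.
Qed.

(** * Hitting times and dense orbits *)

Lemma hitting_posP (X : Type) (f : X -> X) (U V : set X) (n : nat) :
  hitting_pos f U V n <-> exists2 u, U u & V (iter n f u).
Proof.
split; first by case=> _ [[u Uu <-] Vu]; exists u.
by case=> u Uu Vu; exists (iter n f u); split=> //; exists u.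
Qed.

Lemma TT_either (X : topologicalType) (f : X -> X) (U V : set X) :
  TT f -> open U -> U !=set0 -> open V -> V !=set0 ->
  (exists n, exists2 u, U u & V (iter n f u)) \/
  (exists n, exists2 v, V v & U (iter n f v)).
Proof.
move=> fTT Uo U0 Vo V0; have [[n|n] [w [Uw Vw]]] := fTT _ _ Uo U0 Vo V0.
  by left; exists n; case: Uw Vw => u Uu <- Vu; exists u.
by right; exists n.+1, w.
Qed.

Lemma TT_isolated {X : topologicalType} {f : X -> X} {x y : X} :
  TT f -> open [set x] -> open [set y] ->
  (exists n, iter n f x = y) \/ (exists n, iter n f y = x).
Proof.
move=> fTT xo yo; have x0 : [set x] !=set0 by exists x.
have y0 : [set y] !=set0 by exists y.
have [[n [_ -> e]]|[n [_ -> e]]] := TT_either fTT xo x0 yo y0.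
  by left; exists n.
by right; exists n.
Qed.

Lemma TTp_isolated {X : topologicalType} {f : X -> X} {x : X} {U : set X} :
  TTp f -> open U -> U !=set0 -> open [set x] ->
  exists n, exists2 u, U u & iter n f u = x.
Proof.
move=> fTT Uo U0 xo; have x0 : [set x] !=set0 by exists x.
by have [n /hitting_posP[u Uu e]] := fTT _ _ Uo U0 xo x0; exists n, u.
Qed.

Lemma TTpp_TTp (X : topologicalType) (f : X -> X) : TTpp f -> TTp f.
Proof.
by move=> fTT U V Uo U0 Vo V0; apply: infinite_setN0; exact: fTT.
Qed.

Lemma dense_orbit_meets {X : topologicalType} {f : X -> X} {y : X} {U : set X} :
  transitive_point f y -> open U -> U !=set0 -> exists n, U (iter n f y).
Proof. by move=> yd Uo U0; have [z [Uz [n _ fy]]] := yd _ U0 Uo; exists n; rewrite fy. Qed.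

Lemma dense_orbit_isolated {X : topologicalType} {f : X -> X} {x y : X} :
  transitive_point f y -> open [set x] -> exists n, iter n f y = x.
Proof. by move=> yd xo; apply: dense_orbit_meets yd xo _; exists x. Qed.

Lemma omega_limit_meets {X : topologicalType} {f : X -> X} {y : X} {U : set X}
    (k : nat) :
  omega_limit f y = [set: X] -> open U -> U !=set0 ->
  exists2 n, (k <= n)%N & U (iter n f y).
Proof.
move=> yw Uo [u Uu]; have : omega_limit f y u by rewrite yw.
move=> /(_ k I U); case; first exact: open_nbhs_nbhs.
by move=> _ [[n kn <-] Un]; exists n.
Qed.

Lemma DOpp_DOp (X : topologicalType) (f : X -> X) : DOpp f -> DOp f.
Proof.
move=> [y yw]; exists y => U U0 Uo.
have [n _ Un] := omega_limit_meets 0 yw Uo U0.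
by exists (iter n f y); split=> //; exists n.
Qed.

Lemma unbounded_infinite (A : set nat) :
  (forall k, exists2 n, (k <= n)%N & A n) -> infinite_set A.
Proof.
move=> Aub /finite_seqP[s As].
have [n sn An] := Aub (\max_(i <- s) i).+1.
have ns : n \in s by move: An; rewrite As.
by move: sn; rewrite ltnNge (@leq_bigmax_seq nat s xpredT id n).
Qed.

Lemma dense_cycle_TTpp (X : topologicalType) (f : X -> X) (y : X) :
  transitive_point f y -> periodic f y -> TTpp f.
Proof.
move=> yd [[//|p] _ fy] U V Uo U0 Vo V0; apply: unbounded_infinite => k.
have [a Ua] := dense_orbit_meets yd Uo U0.
have [b Vb] := dense_orbit_meets yd Vo V0.
(* From time [a], wait until time [b] modulo the period [p.+1], so that the
   total time [n + a] is [b + p.+1 * (a + k)]. *)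
exists (b + p * a + p.+1 * k)%N.
  by apply: leq_trans (leq_addl _ _); rewrite leq_pmull.
apply/hitting_posP; exists (iter a f y) => //; rewrite -iterD.
have -> : (b + p * a + p.+1 * k + a = b + p.+1 * (a + k))%N.
  by rewrite addnAC mulnDr (mulSn p a) (addnC a) !addnA.
by rewrite iterD iter_fixM.
Qed.

Lemma dense_cycle_DOpp (X : topologicalType) (f : X -> X) (y : X) :
  transitive_point f y -> periodic f y -> DOpp f.
Proof.
move=> yd [p p0 fy]; exists y; apply/seteqP; split=> // z _ k _ B zB.
have [b Bb] : exists b, B° (iter b f y).
  apply: (dense_orbit_meets yd); first exact: open_interior.
  by exists z.
exists (iter b f y); split; last exact: interior_subset.
exists (b + p * k)%N; last by rewrite iterD iter_fixM.
by rewrite /= (leq_trans _ (leq_addl _ _))// leq_pmull.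
Qed.

(** * Isolated points and fibers *)

Lemma Iso_open (X : topologicalType) (x : X) : Iso X x <-> open [set x].
Proof.
split=> [[_ [V Vx]]|xo].
  rewrite setIT => Vset; move: Vx; rewrite Vset openE => xx.
  by move=> _ ->.
split; first by rewrite in_setT.
by exists [set x]; [exact: open_nbhs_nbhs|rewrite setIT].
Qed.

Lemma quasi_continuous_fiber {X : topologicalType} {f : X -> X} {z : X} {U : set X} :
  quasi_continuous f -> open [set f z] -> open U -> U z ->
  exists V : set X, [/\ open V, V !=set0, V `<=` U & forall v, V v -> f v = f z].
Proof.
move=> fqc fzo Uo Uz; have [V [Vo V0 VU fV]] := fqc _ _ _ fzo erefl Uo Uz.
by exists V; split=> // v Vv; apply: fV; exists v.
Qed.

Lemma isolated_of_fiber (X : topologicalType) (f : X -> X) (z : X) (U : set X) :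
  quasi_continuous f -> open [set f z] -> open U -> U z ->
  (forall w, U w -> f w = f z -> w = z) -> open [set z].
Proof.
move=> fqc fzo Uo Uz Uinj.
have [V [Vo [v Vv] VU fV]] := quasi_continuous_fiber fqc fzo Uo Uz.
have Vz w : V w -> w = z by move=> Vw; apply: Uinj; [exact: VU|exact: fV].
suff <- : V = [set z] by [].
by apply/seteqP; split=> [w /Vz//|_ ->]; rewrite -(Vz v).
Qed.

Lemma isolated_of_fiber1 (X : topologicalType) (f : X -> X) (z : X) :
  quasi_continuous f -> open [set f z] ->
  (forall w, f w = f z -> w = z) -> open [set z].
Proof.
move=> fqc fzo finj.
by apply: (@isolated_of_fiber _ f z setT) => // [|w _]; [exact: openT|exact: finj].
Qed.

Lemma isolated_of_fiber2 (X : topologicalType) (f : X -> X) (a b : X) :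
  hausdorff_space X -> quasi_continuous f -> a <> b -> open [set f a] ->
  (forall w, f w = f a -> w = a \/ w = b) -> open [set a].
Proof.
move=> XH fqc ab fao fib.
apply: (@isolated_of_fiber _ f a (~` [set b])) => //.
  exact/closed_openC/accessible_closed_set1/hausdorff_accessible.
by move=> w wb /fib[|/wb].
Qed.

Lemma card_I1_ex (X : Type) (A : set X) :
  (A #= `I_1)%card -> exists a, A = [set a].
Proof.
move=> /eq_cardSP[a Aa]; rewrite II0 card_eq0 => /eqP Aa0.
exists a; apply/seteqP; split=> [w Aw|_ ->//].
by apply: contrapT => wa; rewrite -[False]/(set0 w) -Aa0.
Qed.

Lemma card_I2_ex (X : Type) (A : set X) :
  (A #= `I_2)%card -> exists a b, a <> b /\ A = [set a; b].
Proof.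
move=> /eq_cardSP[a Aa] /card_I1_ex[b Ab].
have [Abb ba] : (A `\ a) b by rewrite Ab.
exists a, b; split; first by move=> e; apply: ba.
apply/seteqP; split=> [w Aw|w [->//|->//]].
have [->|wa] := pselect (w = a); [by left|right].
by rewrite -Ab.
Qed.

(** * Singleton fibers over the isolated points *)

Lemma isolated_preimage (X : topologicalType) (f : X -> X) :
  quasi_continuous f ->
  (forall x, open [set x] -> (f @^-1` [set x] #= `I_1)%card) ->
  forall n z, open [set iter n f z] -> open [set z].
Proof.
move=> fqc fib; elim=> [//|n IH] z fzo; apply: IH.
apply: (@isolated_of_fiber1 _ f) => // w.
have [c fibc] := card_I1_ex (fib _ fzo).
have memc v : f v = iter n.+1 f z -> v = c.
  by move=> fv; have : (f @^-1` [set iter n.+1 f z]) v by []; rewrite fibc.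
by move=> /memc ->; rewrite (memc (iter n f z)).
Qed.

(** The starting point [y] lies behind an isolated point, so [y] and its preimage
    are both isolated; the orbit must visit this preimage and then return to
    [y]. *)
Lemma dense_orbit_cycle (X : topologicalType) (f : X -> X) (x y : X) :
  quasi_continuous f ->
  (forall x, open [set x] -> (f @^-1` [set x] #= `I_1)%card) ->
  open [set x] -> transitive_point f y -> periodic f y.
Proof.
move=> fqc fib xo yd; have back := isolated_preimage fqc fib.
have [n fy] := dense_orbit_isolated yd xo.
have yo : open [set y] by apply: (back n); rewrite fy.
have [z fibz] := card_I1_ex (fib y yo).
have fz : f z = y by rewrite -[_ = _]/((f @^-1` [set y]) z) fibz.
have zo : open [set z] by apply: (back 1%N); rewrite /= fz.
have [m fm] := dense_orbit_isolated yd zo.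
by exists m.+1 => //=; rewrite fm.
Qed.

(** Every nonempty open set meets the backward orbit of [x], which consists of
    isolated points; TT+ applied to the two singletons shows that the forward
    orbit of [x] visits them as well. *)
Lemma TTp_dense_orbit (X : topologicalType) (f : X -> X) (x : X) :
  quasi_continuous f ->
  (forall x, open [set x] -> (f @^-1` [set x] #= `I_1)%card) ->
  open [set x] -> TTp f -> transitive_point f x.
Proof.
move=> fqc fib xo fTT U U0 Uo; have [m [u Uu fu]] := TTp_isolated fTT Uo U0 xo.
have uo : open [set u] by apply: (isolated_preimage fqc fib (n := m)); rewrite fu.
have x0 : [set x] !=set0 by exists x.
have [k [_ -> fx]] := TTp_isolated fTT xo x0 uo.
by exists u; split=> //; exists k.
Qed.

(** * A branching isolated point *)

(** Two disjoint open pieces of the fiber over [a] communicate by TT, and a path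
    from one to the other leads from [a] back to [a]. *)
Lemma nonperiodic_fiber (X : topologicalType) (f : X -> X) (a z z' : X) :
  hausdorff_space X -> quasi_continuous f -> TT f -> open [set a] ->
  ~ periodic f a -> f z = a -> f z' = a -> z = z'.
Proof.
move=> XH fqc fTT ao aper fz fz'; apply: contrapT => /eqP zz'.
move: XH; rewrite open_hausdorff => /(_ _ _ zz')[[A B] /= [/set_mem Az /set_mem Bz']].
move=> [Ao Bo /eqP AB0].
have fzo : open [set f z] by rewrite fz.
have fzo' : open [set f z'] by rewrite fz'.
have [V [Vo V0 VA fV]] := quasi_continuous_fiber fqc fzo Ao Az.
have [W [Wo W0 WB fW]] := quasi_continuous_fiber fqc fzo' Bo Bz'.
have loop n u : f u = a -> f (iter n f u) = a -> n = 0%N.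
  case: n => // n fu fnu; exfalso; apply: aper; exists n.+1 => //.
  by rewrite -{1}fu -iterSr iterS.
have AB w : A w -> B w -> False.
  by move=> Aw Bw; have : (A `&` B) w by []; rewrite AB0.
have [[n [v Vv Wv]]|[n [w Ww Vw]]] := TT_either fTT Vo V0 Wo W0.
  have n0 : n = 0%N by apply: (loop n v); [rewrite fV|rewrite fW].
  by move: Wv; rewrite n0 => Wv; apply: (AB v); [exact: VA|exact: WB].
have n0 : n = 0%N by apply: (loop n w); [rewrite fW|rewrite fV].
by move: Vw; rewrite n0 => Vw; apply: (AB w); [exact: VA|exact: WB].
Qed.

Lemma nonperiodic_backward_chain (X : topologicalType) (f : X -> X) (a : X) :
  hausdorff_space X -> quasi_continuous f -> TT f ->
  (forall z, open [set z] -> f @^-1` [set z] !=set0) ->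
  open [set a] -> ~ periodic f a ->
  forall n, exists2 z, open [set z] & iter n f z = a.
Proof.
move=> XH fqc fTT fsurj ao aper; elim=> [|n [z zo fz]]; first by exists a.
have zper : ~ periodic f z by move=> zp; apply: aper; rewrite -fz; exact: periodic_iter.
have [w fw] := fsurj z zo; exists w; last by rewrite iterSr fw.
apply: (isolated_of_fiber1 fqc); first by rewrite fw.
by move=> v; rewrite fw => fv; exact: nonperiodic_fiber XH fqc fTT zo zper fv fw.
Qed.

(** Of the two preimages, the one reached from the other by TT is reached
    through [x] and maps to [x]: it closes a cycle. *)
Lemma branching (X : topologicalType) (f : X -> X) (x : X) :
  hausdorff_space X -> quasi_continuous f -> TT f -> open [set x] ->
  (f @^-1` [set x] #= `I_2)%card ->
  periodic f x /\ exists c, [/\ open [set c], f c = x & ~ periodic f c].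
Proof.
move=> XH fqc fTT xo /card_I2_ex[a [b [ab fibx]]].
have fa : f a = x by rewrite -[_ = _]/((f @^-1` [set x]) a) fibx; left.
have fb : f b = x by rewrite -[_ = _]/((f @^-1` [set x]) b) fibx; right.
have fib w : f w = x -> w = a \/ w = b.
  by move=> fw; have : (f @^-1` [set x]) w by []; rewrite fibx.
have ao : open [set a].
  by apply: (@isolated_of_fiber2 _ f a b); rewrite ?fa.
have bo : open [set b].
  apply: (@isolated_of_fiber2 _ f b a); rewrite ?fb => //; first exact/nesym.
  by move=> w /fib[]; [right|left].
have ahead c d n : c <> d -> f c = x -> f d = x -> open [set c] ->
    iter n f c = d ->
    periodic f x /\ exists c, [/\ open [set c], f c = x & ~ periodic f c].
  case: n => [//|n] cd fc fd co; rewrite iterSr fc => cnd.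
  have dper : periodic f d by exists n.+1; rewrite // iterSr fd.
  split; first by rewrite -fd; exact: (periodic_iter 1).
  exists c; split=> // cper; apply: cd; apply: periodic_inj cper dper _.
  by rewrite fc.
have [[n fn]|[n fn]] := TT_isolated fTT ao bo; first exact: (ahead a b n).
by apply: (ahead b a n) => //; exact/nesym.
Qed.

(** A forward path between the two points leaves one of them through its periodic
    image, and so stays on a cycle, which the other point avoids: the path has
    length 0. *)
Lemma nonperiodic_preimage_unique (X : topologicalType) (f : X -> X) (c d : X) :
  TT f -> open [set c] -> open [set d] ->
  periodic f (f c) -> periodic f (f d) -> ~ periodic f c -> ~ periodic f d ->
  c = d.
Proof.
move=> fTT co do_ fcper fdper cper dper.
have [[[//|n]]|[[//|n]]] := TT_isolated fTT co do_; rewrite iterSr => e.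
  by case: dper; rewrite -e; exact: periodic_iter.
by case: cper; rewrite -e; exact: periodic_iter.
Qed.

Lemma nonperiodic_not_TTp (X : topologicalType) (f : X -> X) (c : X) :
  open [set c] -> ~ periodic f c -> periodic f (f c) -> open [set f c] ->
  ~ TTp f.
Proof.
move=> co cper fcper fco fTT; have fc0 : [set f c] !=set0 by exists (f c).
have [n [_ -> e]] := TTp_isolated fTT fco fc0 co.
by apply: cper; rewrite -e; exact: periodic_iter.
Qed.

Lemma nonperiodic_not_DOp (X : topologicalType) (f : X -> X) (c : X) :
  hausdorff_space X -> quasi_continuous f -> TT f ->
  (forall z, open [set z] -> f @^-1` [set z] !=set0) ->
  open [set c] -> ~ periodic f c -> ~ DOp f.
Proof.
move=> XH fqc fTT fsurj co cper [y yd].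
have [m fm] := dense_orbit_isolated yd co.
have [z zo fz] := nonperiodic_backward_chain XH fqc fTT fsurj co cper m.+1.
have [k fk] := dense_orbit_isolated yd zo.
apply: cper; exists k.+1 => //.
by rewrite -{1}fm -iterD addSnnS addnC iterD fk.
Qed.

(** * The trichotomy *)

Theorem theorem5p6 (X : topologicalType) (f : X -> X)
    (X_two_points : exists a b : X, a <> b)
    (X_hausdorff : hausdorff_space X)
    (f_qc : quasi_continuous_system f)
    (Iso_nonempty : Iso X !=set0)
    (f_TT : TT f) :
  [/\ (forall x : X, Iso X x -> f @^-1` [set x] = set0 ->
         [/\ (forall y : X, Iso X y -> f @^-1` [set y] = set0 -> y = x),
             DOp f,
             transitive_point f x,
             (forall y : X, transitive_point f y -> y = x)
           & [/\ ~ TTp f, ~ TTpp f & ~ DOpp f]]),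
      ((forall x : X, Iso X x -> (f @^-1` [set x] #= `I_1)%card) ->
         [/\ DOp f, TTp f, TTpp f & DOpp f] \/
         [/\ ~ DOp f, ~ TTp f, ~ TTpp f & ~ DOpp f])
    & ((forall z : X, Iso X z -> f @^-1` [set z] !=set0) ->
       forall x : X, Iso X x -> (f @^-1` [set x] #= `I_2)%card ->
         (forall y : X, Iso X y -> (f @^-1` [set y] #= `I_2)%card -> y = x) /\
         [/\ ~ DOp f, ~ TTp f, ~ DOpp f & ~ TTpp f])].
Proof.
have fqc : quasi_continuous f := f_qc 1%N.
split.
- move=> x /Iso_open xo fx0.
  (* [x] can only be reached at time 0, from [x] itself. *)
  have src n u : iter n f u = x -> n = 0%N.
    case: n => // n fu; exfalso.
    by rewrite -[False]/(set0 (iter n f u)) -fx0.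
  have xd : transitive_point f x.
    move=> U U0 Uo; have x0 : [set x] !=set0 by exists x.
    have [[n [_ -> Un]]|[n [u Uu fu]]] := TT_either f_TT xo x0 Uo U0.
      by exists (iter n f x); split=> //; exists n.
    exists x; split; last by exists 0%N.
    by move: (fu); rewrite (src n u)// => <-.
  have xu y : transitive_point f y -> y = x.
    move=> yd; have [n fy] := dense_orbit_isolated yd xo.
    by move: (fy); rewrite (src n y).
  have nTTp : ~ TTp f.
    move=> fTT; have Uo : open (~` [set x]).
      exact/closed_openC/accessible_closed_set1/hausdorff_accessible.
    have U0 : ~` [set x] !=set0.
      have [a [b ab]] := X_two_points; have [ax|ax] := pselect (a = x).
        by exists b => bx; apply: ab; rewrite ax bx.
      by exists a.
    have [n [u ux fu]] := TTp_isolated fTT Uo U0 xo.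
    by apply: ux; move: (fu); rewrite (src n u).
  split=> //; first 1 last.
  + by exists x.
  + split=> //; first by move=> /TTpp_TTp.
    move=> [y yw]; have x0 : [set x] !=set0 by exists x.
    by have [n n0 fy] := omega_limit_meets 1 yw xo x0; move: n0; rewrite (src n y fy).
  move=> y /Iso_open yo fy0; have [n fx] := dense_orbit_isolated xd yo.
  case: n fx => [//|n fx].
  by exfalso; rewrite -[False]/(set0 (iter n f x)) -fy0.
- move=> fibI; have [x0 /Iso_open xo] := Iso_nonempty.
  have fib x : open [set x] -> (f @^-1` [set x] #= `I_1)%card.
    by move=> /Iso_open; exact: fibI.
  have TTp_DOp : TTp f -> DOp f.
    by move=> fTT; exists x0; exact: TTp_dense_orbit.
  have [fDO|nDO] := pselect (DOp f); [left|right].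
    have [y yd] := fDO; have yper := dense_orbit_cycle fqc fib xo yd.
    have fTT := dense_cycle_TTpp yd yper.
    by split=> //; [exact: TTpp_TTp|exact: dense_cycle_DOpp yd yper].
  by split=> //; [move/TTp_DOp|move/TTpp_TTp/TTp_DOp|move/DOpp_DOp].
- move=> fsurjI x /Iso_open xo x2.
  have fsurj z : open [set z] -> f @^-1` [set z] !=set0.
    by move=> /Iso_open; exact: fsurjI.
  have [xper [c [co fc cper]]] := branching X_hausdorff fqc f_TT xo x2.
  have nDO : ~ DOp f := nonperiodic_not_DOp X_hausdorff fqc f_TT fsurj co cper.
  have nTT : ~ TTp f by apply: (@nonperiodic_not_TTp _ f c); rewrite ?fc.
  split; last by split=> //; [move/DOpp_DOp|move/TTpp_TTp].
  move=> y /Iso_open yo y2.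
  have [yper [d [do_ fd dper]]] := branching X_hausdorff fqc f_TT yo y2.
  rewrite -fc -fd; congr f.
  by apply: (nonperiodic_preimage_unique f_TT); rewrite ?fc ?fd.
Qed.
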